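(* Let $X$ be a Hausdorff locally compact space and $\sigma\colon\mathrm{Dom}(\sigma)\to\mathrm{Ran}(\sigma)$ a local homeomorphism between open subsets of $X$, with Deaconu–Renault groupoid $\mathcal{G}_\sigma$. For $Y\subset X\times\mathbb{T}$ put $Y_x=\{z\in\mathbb{T}:(x,z)\in Y\}$. Then $Y$ equals $q^{-1}(C)$ for some $\mathcal{G}_\sigma$-invariant closed subset $C\subset\mathrm{Stab}(\mathcal{G}_\sigma)^\wedge$ if and only if: (i) $Y$ is closed in $X\times\mathbb{T}$ (product topology); (ii) $Y_x=Y_{\sigma(x)}$ for all $x\in\mathrm{Dom}(\sigma)$; (iii) if $Y_{x_0}\ne\emptyset,\mathbb{T}$, then $x_0$ is periodic, $e^{2\pi i/p(x_0)}Y_{x_0}=Y_{x_0}$, and there is a neighbourhood $V$ of $x_0$ such that $Y_x=\emptyset$ for all $x\in V$ with $l(x)\ne l(x_0)$.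
   Context: Set $\sigma^0=\mathrm{id}_X$, and for $n\ge1$ let $\sigma^n$ be the $n$-fold composition with its natural domain $\mathrm{Dom}(\sigma^n)$. $\mathcal{G}_\sigma=\{(x,m-n,y): m,n\ge0,\ x\in\mathrm{Dom}(\sigma^m),\ y\in\mathrm{Dom}(\sigma^n),\ \sigma^m(x)=\sigma^n(y)\}$ with $r(x,p,y)=x$, $s(x,p,y)=y$, $(x,p,y)(y,q,w)=(x,p+q,w)$, unit space identified with $X$, and topology with basis $Z(U,m,n,V)=\{(x,m-n,y): x\in U\cap\mathrm{Dom}(\sigma^m),\ y\in V\cap\mathrm{Dom}(\sigma^n),\ \sigma^m(x)=\sigma^n(y)\}$ ($U,V$ open); it is a Hausdorff locally compact étale groupoid with abelian isotropy $(\mathcal{G}_\sigma)^x_x=\{(x,l,x)\}$ and grading $\Phi(x,l,y)=l$. $\mathrm{Stab}(\mathcal{G}_\sigma)^\wedge$ is the set of pairs $(x,\chi)$, $\chi$ a character of $(\mathcal{G}_\sigma)^x_x$, with topology having as basis finite intersections of $\mathcal{O}(U,K,V)=\{(x,\chi): x\in U,\ \chi(K\cap(\mathcal{G}_\sigma)^x_x)\subset V\}$ ($U\subset X$ open, $K$ compact in the isotropy bundle, $V\subset\mathbb{T}$ open); $\mathcal{G}_\sigma$ acts by $g(x,\chi)=(r(g),\chi(g^{-1}\cdot g))$ for $s(g)=x$. The map $q\colon X\times\mathbb{T}\to\mathrm{Stab}(\mathcal{G}_\sigma)^\wedge$ is $q(x,z)=(x,\ (x,l,x)\mapsto z^l)$.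 A point $x$ is periodic if $\sigma^{n+p}(x)=\sigma^n(x)$ for some $p\ge1$, $n\ge0$; then $p(x)$ is the smallest such $p$ and $l(x)$ is the smallest $l\ge0$ with $\sigma^{p(x)+l}(x)=\sigma^l(x)$; for non-periodic $x$, $p(x)=l(x)=\infty$. *)

(* Defs.v *)
From HB Require Import structures.
From mathcomp Require Import all_boot all_order all_algebra.
From mathcomp Require Import all_classical all_reals topology normedtype trigo.
From mathcomp.real_closed Require Import complex.
Import Order.TTheory GRing.Theory Num.Theory.
Import numFieldNormedType.Exports.

Set Implicit Arguments.
Unset Strict Implicit.
Unset Printing Implicit Defensive.

Local Open Scope classical_set_scope.
Local Open Scope ring_scope.

(* The complex numbers over a real type R, with their Euclidean (normed) topology. *)
Definition CC (R : realType) := (R[i] : numClosedFieldType).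

Definition Tset (R : realType) : set (CC R) := [set z | `|z| = 1].
Arguments Tset R : clear implicits.

Definition rotp (R : realType) (p : nat) : CC R :=
  (cos (2 * pi / p%:R) +i* sin (2 * pi / p%:R))%C.
Arguments rotp R p : clear implicits.

(* sigma : Dom(sigma) -> Ran(sigma) is a local homeomorphism onto open subsets:
   Dom open, and each point of Dom has an open neighbourhood U in Dom on which
   sigma is injective, continuous and open (so a homeomorphism onto the open set
   sigma(U)); Ran(sigma) = sigma(Dom) is then open. *)
Definition local_homeo (X : topologicalType) (Dom : set X) (sigma : X -> X) :=
  open Dom /\
  forall x, Dom x -> exists U : set X,
    [/\ open U, U x, U `<=` Dom,
        (forall a b, U a -> U b -> sigma a = sigma b -> a = b) &
        ({within U, continuous sigma} /\
         (forall W, open W -> W `<=` U -> open (sigma @` W)))].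

Section DR.
Context (R : realType) (X : topologicalType) (Dom : set X) (sigma : X -> X).

Definition domn (n : nat) (x : X) := forall k, (k < n)%N -> Dom (iter k sigma x).

Definition Triple := (X * int * X)%type.

Definition Gset : set Triple :=
  [set g | exists m n : nat, [/\ domn m g.1.1, domn n g.2,
            iter m sigma g.1.1 = iter n sigma g.2 & g.1.2 = (m%:Z - n%:Z)%R]].

Definition gmul (g h : Triple) : Triple := (g.1.1, (g.1.2 + h.1.2)%R, h.2).
Definition ginv (g : Triple) : Triple := (g.2, (- g.1.2)%R, g.1.1).

Definition ZB (U : set X) (m n : nat) (V : set X) : set Triple :=
  [set g | [/\ U g.1.1, V g.2, domn m g.1.1, domn n g.2 &
              (iter m sigma g.1.1 = iter n sigma g.2 /\ g.1.2 = (m%:Z - n%:Z)%R)]].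

Definition Gopen (W : set Triple) :=
  forall g, W g -> exists (U : set X) (m n : nat) (V : set X),
    [/\ open U, open V, ZB U m n V g & ZB U m n V `<=` W].

Definition Gcompact (K : set Triple) :=
  forall F : set (set Triple), (forall W, F W -> Gopen W) ->
    K `<=` \bigcup_(W in F) W ->
    exists (n : nat) (f : 'I_n -> set Triple),
      (forall i, F (f i)) /\ K `<=` \bigcup_(i in [set: 'I_n]) f i.

Definition Iso : set Triple := [set g | Gset g /\ g.1.1 = g.2].

Definition Hx (x : X) : set int := [set k | Gset (x, k, x)].

(* a character of (G_sigma)^x_x, encoded as chi : int -> CC R (chi l is the
   value at (x,l,x)), normalized to 1 off the isotropy group *)
Definition isChar (x : X) (chi : int -> CC R) :=
  [/\ (forall k, Hx x k -> Tset R (chi k)),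
      (forall k l, Hx x k -> Hx x l -> chi (k + l)%R = chi k * chi l) &
      (forall k, ~ Hx x k -> chi k = 1)].

Definition SP := (X * (int -> CC R))%type.

Definition Stab : set SP := [set s | isChar s.1 s.2].

Definition Obasic (B : set X * set Triple * set (CC R)) : set SP :=
  [set s | [/\ Stab s, B.1.1 s.1 & forall k, B.1.2 (s.1, k, s.1) -> B.2 (s.2 k)]].

Definition admissible (B : set X * set Triple * set (CC R)) :=
  [/\ open B.1.1, Gcompact B.1.2, B.1.2 `<=` Iso &
      exists O : set (CC R), open O /\ B.2 = O `&` Tset R].

Definition Stab_open (W : set SP) :=
  W `<=` Stab /\
  forall s, W s -> exists (n : nat) (B : 'I_n -> set X * set Triple * set (CC R)),
    [/\ forall i, admissible (B i),
        forall i, Obasic (B i) s &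
        forall t, Stab t -> (forall i, Obasic (B i) t) -> W t].

Definition Stab_closed (C : set SP) := C `<=` Stab /\ Stab_open (Stab `\` C).

Definition act (g : Triple) (s : SP) : SP :=
  (g.1.1, fun l => s.2 (gmul (gmul (ginv g) (g.1.1, l, g.1.1)) g).1.2).

Definition Ginvariant (C : set SP) :=
  forall g s, Gset g -> g.2 = s.1 -> C s -> C (act g s).

Definition q (p : X * CC R) : SP :=
  (p.1, fun l => if `[< Hx p.1 l >] then p.2 ^ l else 1).

Definition Yfib (Y : set (X * CC R)) (x : X) : set (CC R) := [set z | Y (x, z)].

Definition per_at (x : X) (p n : nat) :=
  domn (n + p) x /\ iter (n + p) sigma x = iter n sigma x.

Definition dr_periodic (x : X) := exists p n, (0 < p)%N /\ per_at x p n.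

Definition pmin (x : X) (p : nat) :=
  [/\ (0 < p)%N, (exists n, per_at x p n) &
      forall p', (0 < p')%N -> (exists n, per_at x p' n) -> (p <= p')%N].

Definition lmin (x : X) (l : nat) :=
  exists p, [/\ pmin x p, per_at x p l & forall l', per_at x p l' -> (l <= l')%N].

(* p(x), l(x); None encodes infinity *)
Definition p_of (x : X) : option nat :=
  if `[< exists p, pmin x p >] then Some (xget 0%N (pmin x)) else None.
Definition l_of (x : X) : option nat :=
  if `[< exists l, lmin x l >] then Some (xget 0%N (lmin x)) else None.

End DR.

(* Main.v *)
(* The subset [C] corresponding to [Y] is [q(Y)], and [q(x, z)] depends on [z] only through
   [z^p(x)] when [x] is periodic, and not at all otherwise.

   If [C] is closed and invariant, the conditions follow from a compactness argument: a basic
   neighbourhood [O(U, K, V)] of a point over [x0] involves only those [(x, k, x)] in [K] that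
   are close to some [(x0, k, x0)] in [K]. By definition of the topology these satisfy, for
   [k <> 0], [sigma^(l + |k|) x = sigma^l x] with [l = l(x0)], which forces [l(x) = l] near
   [x0]. So over the points with [l(x) <> l] the neighbourhood contains all characters.

   Conversely let [z0] lie outside [Y_x0], with [Y_x0] nonempty, and choose [e > 0] such that
   [Y_x] misses the [e]-ball around [z0] for [x] near [x0]. If [Y_x] is nonempty then it is
   invariant under the [p(x)]-th roots of unity, so [p(x)] is bounded by some [N], and for
   [p = p(x)] every [z] in [Y_x] satisfies [|z^p - z0^p| >= e^p], this number being the
   product of the distances from [z0] to the points [zeta z], [zeta^p = 1]. Hence finitely
   many compact sets [{(x, p, x) : sigma^(l + p) x = sigma^l x}], [p <= N + 1], cut out a
   neighbourhood of [q(x0, z0)] disjoint from [q(Y)]. *)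

Require Import Defs.
From HB Require Import structures.
From mathcomp Require Import all_boot all_order all_algebra.
From mathcomp Require Import all_classical all_reals topology normedtype trigo.
From mathcomp.real_closed Require Import complex.
From mathcomp Require Import ring lra zify.
Import Order.TTheory GRing.Theory Num.Theory.
Import numFieldNormedType.Exports.

Set Implicit Arguments.
Unset Strict Implicit.
Unset Printing Implicit Defensive.

Local Open Scope classical_set_scope.
Local Open Scope ring_scope.

(** * Roots of unity on the circle *)

Section Circle.
Context (R : realType).
Implicit Types (t : R) (z w : CC R).

Definition cis t : CC R := (cos t +i* sin t)%C.

Lemma cis0 : cis 0 = 1.
Proof. by rewrite /cis cos0 sin0. Qed.

Lemma cisD t u : cis (t + u) = cis t * cis u.
Proof. by rewrite /cis cosD sinD; congr (_ +i* _)%C; rewrite addrC mulrC [sin u * _]mulrC. Qed.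

Lemma cisMn t n : cis (t *+ n) = cis t ^+ n.
Proof. by elim: n => [|n IH]; rewrite ?mulr0n ?cis0 ?expr0// mulrS cisD IH exprS. Qed.

Lemma cis2pi : cis (pi *+ 2) = 1.
Proof. by rewrite /cis cos2pi sin2pi. Qed.

Lemma norm_cis t : `|cis t| = 1.
Proof. by rewrite normc_def /= cos2Dsin2 sqrtr1. Qed.

(** Keeping the angle in a closed interval gives access to the compactness of the circle in
    [Yfib_empty_near]. *)
Lemma cis_surj z : `|z| = 1 -> exists2 t, 0 <= t <= pi *+ 2 & z = cis t.
Proof.
case: z => a b /eqP; rewrite normc_def /= => /eqP[] h.
have ab1 : a ^+ 2 + b ^+ 2 = 1.
  by rewrite -[LHS]sqr_sqrtr ?h ?expr1n// addr_ge0 ?sqr_ge0.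
have a1 : -1 <= a <= 1 by apply/andP; split; nra.
have sE : sin (acos a) = `|b|.
  by rewrite sin_acos// -sqrtr_sqr; congr Num.sqrt; lra.
have cE : cos (acos a) = a by rewrite acosK// in_itv.
have ge0 := acos_ge0 a1; have lepi := acos_lepi a1.
have [b0|b0] := leP 0 b.
  exists (acos a); first by rewrite ge0 /= mulr2n (le_trans lepi)// lerDl pi_ge0.
  by rewrite /cis cE sE ger0_norm.
exists (pi *+ 2 - acos a).
  rewrite subr_ge0 mulr2n lerBlDr lerDl ge0 andbT.
  by rewrite (le_trans lepi)// lerDl pi_ge0.
by rewrite cisD cis2pi mul1r /cis cosN sinN cE sE ltr0_norm// opprK.
Qed.

Lemma rotpE p : rotp R p = cis (pi *+ 2 / p%:R).
Proof. by rewrite /rotp mulr_natl. Qed.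

(** By the half-angle formula the value 1 would force [sin (t / 2) = 0], but [t / 2] lies strictly
    between 0 and [pi]. *)
Lemma cis_neq1 t : 0 < t < pi *+ 2 -> cis t != 1.
Proof.
move=> /andP[t0 t2]; apply/eqP => -[] ct _.
have s0 : 0 < sin (t / 2) by rewrite sin_gt0_pi; lra.
have e : cos t = cos (t / 2) ^+ 2 *+ 2 - 1 by rewrite -cos_mulr2n; congr cos; lra.
move: e; rewrite ct cos2sin2 => e.
have : 0 < sin (t / 2) ^+ 2 by rewrite exprn_gt0.
by lra.
Qed.

(** If the exact order [m] were less than [p], the angle [2 pi m / p] would contradict
    [cis_neq1]. *)
Lemma rotp_prim p : (0 < p)%N -> p.-primitive_root (rotp R p).
Proof.
move=> p0; have pR : 0 < p%:R :> R by rewrite ltr0n.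
have rp : rotp R p ^+ p = 1.
  by rewrite rotpE -cisMn -(mulr_natr (_ / _)) divfK ?gt_eqF// cis2pi.
have [m prm mp] := prim_order_exists p0 rp.
have [mp1|ltmp] : m = p \/ (m < p)%N.
- by move: (dvdn_leq p0 mp); rewrite leq_eqVlt => /predU1P.
- by rewrite -[X in X.-primitive_root _]mp1.
have m0 := prim_order_gt0 prm.
have : cis ((pi *+ 2 / p%:R) *+ m) != 1; last first.
  by rewrite cisMn -rotpE (prim_expr_order prm) eqxx.
apply: cis_neq1.
have pi20 : 0 < pi *+ 2 :> R by rewrite pmulrn_lgt0// pi_gt0.
rewrite -(mulr_natr (_ / _)) mulrAC; apply/andP; split.
  by rewrite divr_gt0// mulr_gt0// ltr0n.
by rewrite ltr_pdivrMr// ltr_pM2l// ltr_nat.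
Qed.

Lemma norm_rotp p : `|rotp R p| = 1.
Proof. by rewrite rotpE norm_cis. Qed.

Lemma norm_le_ReIm z : `|z| <= (`|complex.Re z| + `|complex.Im z|)%:C%C.
Proof.
case: z => a b; rewrite normc_def /= lecR.
rewrite -[leRHS]ger0_norm ?addr_ge0// -sqrtr_sqr ler_wsqrtr// sqrrD.
rewrite !real_normK ?num_real//.
by have := mulr_ge0 (normr_ge0 a) (normr_ge0 b); lra.
Qed.

Lemma cis_continuous : continuous cis.
Proof.
move=> t; apply/cvgrPdist_lt => e e0.
move: e0; case: e => r i; rewrite ltcE /= => /andP[/eqP-> r0].
near=> u.
apply: (le_lt_trans (norm_le_ReIm _)); rewrite ltcR /= [ltRHS]splitr ltrD//.
  near: u; apply: (cvgrPdist_lt _ _).1; [exact: continuous_cos|by rewrite divr_gt0].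
near: u; apply: (cvgrPdist_lt _ _).1; [exact: continuous_sin|by rewrite divr_gt0].
Unshelve. all: by end_near. Qed.

Lemma rotp_dense (e : CC R) : 0 < e ->
  exists N, forall p, (N < p)%N -> forall z w, `|z| = 1 -> `|w| = 1 ->
    exists k, `|rotp R p ^+ k * z - w| < e.
Proof.
move=> e0.
have /cvgrPdist_lt/(_ _ e0) := @cis_continuous 0.
rewrite cis0 => /nbhs_ballP[r /= r0 hr].
(* With this bound every larger [p] satisfies [2 pi / p < r]. *)
exists (Num.trunc (pi *+ 2 / r)) => p Np z w z1 w1.
have p0 : 0 < p%:R :> R by rewrite ltr0n (leq_ltn_trans _ Np).
have pi20 : 0 < pi *+ 2 :> R by rewrite pmulrn_lgt0// pi_gt0.
have [t /andP[t0 t2] wz] : exists2 t, 0 <= t <= pi *+ 2 & w / z = cis t.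
  by apply: cis_surj; rewrite normf_div z1 w1 divr1.
have z0 : z != 0 by rewrite -normr_eq0 z1 oner_eq0.
have -> : w = cis t * z by rewrite -wz divfK.
(* [k] counts the full steps of [2 pi / p] contained in [t]; the remainder [d] is then less than one
   step. *)
set k := Num.trunc (t * p%:R / (pi *+ 2)).
have /truncn_itv/andP[k1 k2] : 0 <= t * p%:R / (pi *+ 2).
  by rewrite divr_ge0 ?mulr_ge0 ?(ltW p0) ?(ltW pi20).
set d := t - (pi *+ 2 / p%:R) *+ k.
exists k.
have -> : t = (pi *+ 2 / p%:R) *+ k + d by rewrite /d; lra.
rewrite cisD cisMn -rotpE -mulrBl -{1}[_ ^+ k]mulr1 -mulrBr !normrM normrX norm_rotp.
rewrite expr1n z1 mul1r mulr1; apply: hr; rewrite /ball /= sub0r normrN.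
move: k1 k2; rewrite -/k ler_pdivlMr// ltr_pdivrMr// => k1 k2.
have dE : d * p%:R = t * p%:R - k%:R * (pi *+ 2).
  by rewrite /d mulrBl -(mulr_natr (_ / _)) mulrAC divfK ?gt_eqF// (mulrC _ k%:R).
have d0 : 0 <= d by rewrite -(pmulr_lge0 _ p0) dE subr_ge0.
rewrite ger0_norm// -(ltr_pM2r p0) dE.
move: k2; rewrite -natr1 mulrDl mul1r => k2.
have : pi *+ 2 < r * p%:R.
  rewrite mulrC -ltr_pdivrMr//; apply: lt_le_trans (truncnS_gt _) _.
  by rewrite ler_nat.
by lra.
Qed.

(* [|z^p - w^p|] is the product of the distances from [w] to the points [zeta z], [zeta^p = 1]. *)
Lemma rotp_sub_prod p z w (e : CC R) : (0 < p)%N -> `|z| = 1 -> 0 <= e ->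
  (forall k, e <= `|rotp R p ^+ k * z - w|) -> e ^+ p <= `|z ^+ p - w ^+ p|.
Proof.
move=> p0 z1 e0 he.
have z0 : z != 0 by rewrite -normr_eq0 z1 oner_eq0.
have -> : `|z ^+ p - w ^+ p| = `|\prod_(0 <= i < p) (w / z - rotp R p ^+ i)|.
  have /(congr1 (fun P => P.[w / z])) := factor_Xn_sub_1 (rotp_prim p0).
  rewrite horner_prod !hornerE => E.
  under eq_bigr do rewrite -[_ - _]hornerXsubC.
  rewrite E expr_div_n -[X in w ^+ p / _ - X](divff (expf_neq0 p z0)) -mulrBl.
  by rewrite normf_div normrX z1 expr1n divr1 distrC.
rewrite normr_prod big_mkord -[X in _ ^+ X](card_ord p) -prodr_const.
apply: ler_prod => i _; rewrite e0 /= (le_trans (he i))//.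
have -> : w / z - rotp R p ^+ i = (w - rotp R p ^+ i * z) / z.
  by rewrite mulrBl mulfK.
by rewrite normf_div z1 divr1 distrC.
Qed.

End Circle.

(** * Periods and the isotropy groups *)

Section Periods.
Context (X : topologicalType) (Dom : set X) (sigma : X -> X).
Local Notation dom := (domn Dom sigma).
Local Notation s n := (iter n sigma).
Local Notation per := (per_at Dom sigma).
Local Notation G := (Gset Dom sigma).
Local Notation H := (Hx Dom sigma).
Implicit Types (x y : X) (a b k l m n p : nat).

Lemma iterDr m n x : s (m + n) x = s n (s m x).
Proof. by rewrite addnC iterD. Qed.

Lemma domn_le m n x : (m <= n)%N -> dom n x -> dom m x.
Proof. by move=> mn h i im; apply: h; apply: leq_trans mn. Qed.

Lemma domnD m n x : dom (m + n) x <-> dom m x /\ dom n (s m x).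
Proof.
split=> [h|[hm hn] i imn].
  split=> [|i ilt]; first by apply: domn_le h; rewrite leq_addr.
  by rewrite -iterDr; apply: h; rewrite ltn_add2l.
have [/hm//|mi] := ltnP i m.
by rewrite -(subnKC mi) iterDr; apply: hn; rewrite ltn_subLR.
Qed.

Lemma Gset_inv x y (k : int) : G (x, k, y) -> G (y, - k, x).
Proof.
by move=> [m [n [/= hm hn e ->]]]; exists n, m; split => //=; rewrite opprB.
Qed.

(** The two relations reach [y] with exponents [n] and [m']; iterating [sigma] further on the
    smaller one makes them composable. *)
Lemma Gset_mul x y z (k l : int) : G (x, k, y) -> G (y, l, z) -> G (x, k + l, z).
Proof.
move=> [m [n [/= hm hn e ->]]] [m' [n' [/= hm' hn' e' ->]]].
have [le|/ltnW le] := leqP n m'.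
  exists (m + (m' - n))%N, n'; split => //=; last by rewrite PoszD -subzn//; ring.
    by apply/domnD; split => //; rewrite e; apply: ((domnD n _ y).1 _).2; rewrite subnKC.
  by rewrite iterDr e -iterDr subnKC.
exists m, (n' + (n - m'))%N; split => //=; last by rewrite PoszD -subzn//; ring.
  by apply/domnD; split => //; rewrite -e'; apply: ((domnD m' _ y).1 _).2; rewrite subnKC.
by rewrite iterDr -e' -iterDr subnKC.
Qed.

Lemma Hx_orbit x y (k : int) : G (x, k, y) -> H x = H y.
Proof.
move=> g; apply/seteqP; split=> l h; rewrite /Hx /=.
  have := Gset_mul (Gset_mul (Gset_inv g) h) g.
  by rewrite addrAC addNr add0r.
have := Gset_mul (Gset_mul g h) (Gset_inv g).
by rewrite addrAC addrN add0r.
Qed.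

(** An index from [n + p] on can be lowered by [p] without changing the iterate, so the orbit never
    leaves [Dom]. *)
Lemma per_domn x p n m : (0 < p)%N -> per x p n -> dom m x.
Proof.
move=> p0 [d e]; elim/ltn_ind: m => m IH i im.
have [/d//|le] := ltnP i (n + p).
rewrite -(subnKC le) iterDr e -iterDr.
by apply: (IH i im); lia.
Qed.

Lemma per_le x p m n : (0 < p)%N -> (m <= n)%N -> per x p m -> per x p n.
Proof.
move=> p0 mn h; split; first exact: per_domn h.
by rewrite -(subnKC mn) addnAC iterDr h.2 -iterDr.
Qed.

Lemma per_muln x p n a : (0 < p)%N -> per x p n -> per x (a * p) n.
Proof.
move=> p0 h; split; first exact: per_domn h.
elim: a => [|a IH]; first by rewrite addn0.
by rewrite mulSn addnA iterDr h.2 -iterDr.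
Qed.

Lemma per_subn x a b m n : (0 < a)%N -> (0 < b)%N -> (b <= a)%N ->
  per x a m -> per x b n -> per x (a - b) (maxn m n + b).
Proof.
move=> a0 b0 ba /(per_le a0 (leq_maxl m n)) ha /(per_le b0 (leq_maxr m n)) hb.
split; first exact: per_domn ha.
by rewrite -addnA subnKC// ha.2 hb.2.
Qed.

(** A nonzero remainder of [k] modulo [p] would, by [per_subn], be a smaller period, possibly from a
    later index on. *)
Lemma pmin_dvdn x p k n : pmin Dom sigma x p -> per x k n -> (p %| k)%N.
Proof.
move=> [p0 [n0 h0] hmin] h.
rewrite /dvdn; have [//|r0] := posnP (k %% p)%N.
have k0 : (0 < k)%N by case: k r0 {h}; rewrite ?mod0n.
have pk := hmin k k0 (ex_intro _ _ h).
have q0 : (0 < k %/ p)%N by rewrite divn_gt0.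
have := per_subn k0 _ (leq_divM _ _) h (per_muln _ p0 h0).
rewrite muln_gt0 q0 p0 => /(_ isT).
have -> : (k - k %/ p * p = k %% p)%N by rewrite {1}(divn_eq k p) addKn.
move=> h1; have := hmin _ r0 (ex_intro _ _ h1).
by rewrite leqNgt ltn_pmod.
Qed.

(** The period [p] may be known only from some [n0 > n] on. Advancing by [n0 * k], a multiple of the
    period [k], changes no iterate from [n] on and passes beyond [n0]. *)
Lemma pmin_per x p k n : (0 < k)%N -> pmin Dom sigma x p -> per x k n -> per x p n.
Proof.
move=> k0 [p0 [n0 h0] _] h; split; first exact: per_domn h.
have le : (n0 <= n + n0 * k)%N by have := leq_pmulr n0 k0; lia.
have := (per_le p0 le h0).2; rewrite (per_muln _ k0 h).2 => <-.
have hp := per_le k0 (leq_addr p n) h.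
by rewrite addnAC (per_muln n0 k0 hp).2.
Qed.

Lemma pmin_uniq x p p' : pmin Dom sigma x p -> pmin Dom sigma x p' -> p = p'.
Proof.
move=> [p0 h hm] [p0' h' hm']; apply/eqP.
by rewrite eqn_leq hm//= hm'.
Qed.

Lemma nat_min (P : nat -> Prop) : (exists n, P n) ->
  exists2 n, P n & forall m, P m -> (n <= m)%N.
Proof.
move=> [n Pn].
have ex : exists n, `[< P n >] by exists n; apply/asboolP.
exists (ex_minn ex); case: ex_minnP => m /asboolP // Pm hm k Pk.
by apply: hm; apply/asboolP.
Qed.

Lemma pmin_exists x : dr_periodic Dom sigma x -> exists p, pmin Dom sigma x p.
Proof.
move=> h; have [|p [p0 hp] hm] := @nat_min (fun p => (0 < p)%N /\ exists n, per x p n).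
  by have [p [n [p0 hp]]] := h; exists p; split => //; exists n.
by exists p; split => // p' p0' h'; apply: hm.
Qed.

Lemma lmin_exists x : dr_periodic Dom sigma x -> exists l, lmin Dom sigma x l.
Proof.
move=> /pmin_exists[p hp]; have [_ /nat_min[l hl hm] _] := hp.
by exists l, p.
Qed.

(** [lmin] refers to the least period only; [pmin_per] extends the bound to all periods. *)
Lemma lmin_le x p n l : (0 < p)%N -> per x p n -> lmin Dom sigma x l -> (l <= n)%N.
Proof. by move=> p0 h [q [hq _ hm]]; apply: hm; apply: pmin_per h. Qed.

Lemma lmin_per x p n l : (0 < p)%N -> per x p n -> lmin Dom sigma x l -> per x p l.
Proof.
move=> p0 h [q [hq hl _]]; have /dvdnP[a ->] := pmin_dvdn hq h.
by apply: per_muln => //; case: hq.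
Qed.

Lemma lmin_uniq x l l' : lmin Dom sigma x l -> lmin Dom sigma x l' -> l = l'.
Proof.
move=> h h'; have [p [[p0 _ _] hp _]] := h; have [p' [[p0' _ _] hp' _]] := h'.
by apply/eqP; rewrite eqn_leq (lmin_le p0' hp' h) (lmin_le p0 hp h').
Qed.

Lemma p_of_pmin x p : pmin Dom sigma x p -> p_of Dom sigma x = Some p.
Proof.
move=> h; rewrite /p_of asboolT; last by exists p.
by congr Some; apply: (@pmin_uniq x) => //; apply: xgetPex; exists p.
Qed.

Lemma p_of_Some x p : p_of Dom sigma x = Some p -> pmin Dom sigma x p.
Proof.
rewrite /p_of; case: asboolP => // h [<-]; apply: xgetPex; exact: h.
Qed.

Lemma l_of_lmin x l : lmin Dom sigma x l -> l_of Dom sigma x = Some l.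
Proof.
move=> h; rewrite /l_of asboolT; last by exists l.
by congr Some; apply: (@lmin_uniq x) => //; apply: xgetPex; exists l.
Qed.

Lemma l_of_Some x l : l_of Dom sigma x = Some l -> lmin Dom sigma x l.
Proof.
rewrite /l_of; case: asboolP => // h [<-]; apply: xgetPex; exact: h.
Qed.

Lemma Hx0 x : H x 0.
Proof. by exists 0%N, 0%N; split. Qed.

Lemma Hx_nat x p : H x p%:Z <-> exists n, per x p n.
Proof.
split=> [[m [n [/= hm hn e emn]]]|[n [d e]]].
  have mE : m = (n + p)%N by have : p%:Z = m%:Z - n%:Z := emn; lia.
  by exists n; rewrite /per_at -mE; split.
exists (n + p)%N, n; split => //=; last lia.
by apply: domn_le d; rewrite leq_addr.
Qed.

Lemma Hx_absz x (k : int) : H x k <-> H x `|k|%N.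
Proof.
case: k => k; first by rewrite absz_nat.
by rewrite NegzE abszN absz_nat; split => /Gset_inv; rewrite ?opprK.
Qed.

Lemma Hx_pmin x p (k : int) : pmin Dom sigma x p -> H x k <-> (p %| `|k|)%N.
Proof.
move=> h; rewrite Hx_absz Hx_nat; split=> [[n]|/dvdnP[a ->]].
  exact: pmin_dvdn.
by have [p0 [n hn] _] := h; exists n; apply: per_muln.
Qed.

Lemma Hx_aperiodic x (k : int) : ~ dr_periodic Dom sigma x -> H x k <-> k = 0.
Proof.
move=> h; split=> [|->]; last exact: Hx0.
rewrite Hx_absz Hx_nat => -[n hn]; apply/eqP; rewrite -absz_eq0.
apply/eqP; have [//|k0] := posnP `|k|%N.
by case: h; exists `|k|%N, n.
Qed.

(** * Iterates of a local homeomorphism near a point *)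

Hypothesis lh : local_homeo Dom sigma.

Lemma local_homeo_continuous x : Dom x -> {for x, continuous sigma}.
Proof.
move=> /(lh.2)[U [oU Ux _ _ [+ _]]].
by rewrite continuous_open_subspace// => /(_ x); apply; rewrite inE.
Qed.

Lemma iter_continuous n x : dom n x -> {for x, continuous (iter n sigma)}.
Proof.
elim: n => [|n IH] h; first exact: cvg_id.
have hn : dom n x by apply: domn_le h.
apply: continuous_comp; first exact: IH.
by apply: local_homeo_continuous; apply: h.
Qed.

Lemma domn_nbhs n x : dom n x -> \forall y \near x, dom n y.
Proof.
elim: n => [|n IH] h; first by near=> y.
have hn : dom n x by apply: domn_le h.
have Dx : Dom (s n x) by apply: h.
have nD : \forall y \near x, Dom (s n y).
  by apply: (iter_continuous hn); apply: open_nbhs_nbhs; split => //; exact: lh.1.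
near=> y => i; rewrite ltnS leq_eqVlt => /predU1P[->|].
  by near: y.
by move: i; near: y; apply: IH.
Unshelve. all: by end_near. Qed.

Lemma iter_locally_injective n x : dom n x ->
  exists2 U, nbhs x U & forall y z, U y -> U z -> s n y = s n z -> y = z.
Proof.
elim: n => [|n IH] h; first by exists setT => //; exact: filterT.
have hn : dom n x by apply: domn_le h.
have [U xU Ui] := IH hn.
have /(lh.2)[V [oV Vx _ Vi _]] : Dom (s n x) by apply: h.
exists (U `&` s n @^-1` V).
  apply: filterI => //; apply: (iter_continuous hn).
  exact: open_nbhs_nbhs.
move=> a b [Ua Va] [Ub Vb] /= e.
by apply: Ui => //; apply: Vi.
Qed.

(* If [sigma^(n + p)] and [sigma^n] agree at [x] with [n < l], then near [x] an equality
   [sigma^(l + p) y = sigma^l y] can be cancelled by local injectivity of [sigma^(l - n)]. *)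
Lemma per_near x p l m n : (0 < p)%N -> per x p l ->
    s m x = s n x -> m%:Z - n%:Z = p%:Z ->
  \forall y \near x, per y p l -> s m y = s n y.
Proof.
move=> p0 h e mn.
have -> : m = (n + p)%N by lia.
have [ln|nl] := leqP l n.
  by near=> y => hy; exact: (per_le p0 ln hy).2.
have [U xU Ui] : exists2 U, nbhs (s n x) U & forall y z, U y -> U z ->
    s (l - n) y = s (l - n) z -> y = z.
  by apply: iter_locally_injective; have [_] := (domnD n (l - n) x).1 (per_domn p0 h).
have U1 : \forall y \near x, U (s n y).
  by apply: iter_continuous xU; apply: per_domn h.
have U2 : \forall y \near x, U (s (n + p) y).
  apply: iter_continuous; first exact: per_domn h.
  have <- : m = (n + p)%N by lia.
  by rewrite e.
near=> y => hy; apply: Ui; [by near: y|by near: y|].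
by rewrite -!iterDr addnAC subnKC ?(ltnW nl)// hy.2.
Unshelve. all: by end_near. Qed.

End Periods.

(** * Characters and the map q *)

Section Characters.
Context (R : realType) (X : topologicalType) (Dom : set X) (sigma : X -> X).
Local Notation H := (Hx Dom sigma).
Local Notation Q := (q Dom sigma).
Implicit Types (x y : X) (z w : CC R) (k : int) (chi : int -> CC R).

Lemma cvg_exprz (K : numFieldType) (k : int) (z : K) : z != 0 ->
  w ^ k @[w --> z] --> z ^ k.
Proof.
move=> z0.
have cn n : {for z, continuous (fun w : K => w ^+ n)}.
  elim: n => [|n /(continuousM cvg_id) IH]; first exact: cst_continuous.
  have -> // : (fun w : K => w ^+ n.+1) = id \* (fun w : K => w ^+ n).
  by apply/funext => w; rewrite exprS.
case: k => n; first exact: cn.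
exact: (cvgV (expf_neq0 n.+1 z0) (cn n.+1)).
Qed.

Lemma Tset_neq0 z : Tset R z -> z != 0.
Proof. by rewrite /Tset /= -normr_eq0 => ->; rewrite oner_eq0. Qed.

Lemma TsetXz k z : Tset R z -> Tset R (z ^ k).
Proof.
move=> z1; case: k => n; rewrite /Tset /=; first by rewrite normrX z1 expr1n.
by rewrite normfV normrX z1 expr1n invr1.
Qed.

Lemma TsetM z w : Tset R z -> Tset R w -> Tset R (z * w).
Proof. by rewrite /Tset /= normrM => -> ->; rewrite mulr1. Qed.

Lemma qE x z k : H x k -> (Q (x, z)).2 k = z ^ k.
Proof. by move=> h; rewrite /q /= asboolT. Qed.

Lemma q_ext x z w : (forall k, H x k -> z ^ k = w ^ k) -> Q (x, z) = Q (x, w).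
Proof.
move=> h; rewrite /q /=; congr (_, _); apply/funext => k.
by case: asboolP => // /h.
Qed.

Lemma q_Stab x z : Tset R z -> Stab Dom sigma (Q (x, z)).
Proof.
move=> z1; split=> [k hk|k l hk hl|k hk] /=; last by rewrite asboolF.
  by rewrite asboolT//; exact: TsetXz.
by rewrite !asboolT ?expfzDr ?Tset_neq0//; exact: Gset_mul hk hl.
Qed.

Lemma q_eq_pmin x p z w : pmin Dom sigma x p ->
  Q (x, z) = Q (x, w) <-> z ^+ p = w ^+ p.
Proof.
move=> hp; split=> [e|e].
  have hx : H x p by apply/(Hx_pmin _ hp); rewrite absz_nat.
  by move: (congr1 (fun s : SP R X => s.2 p) e); rewrite !qE.
apply: q_ext => k /(Hx_pmin _ hp)/dvdnP[a].
case: k => n; rewrite ?NegzE ?abszN absz_nat => ->.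
  by rewrite -!exprnP mulnC !exprM e.
by rewrite -!exprnN mulnC !exprM e.
Qed.

Lemma q_rotp x p z : pmin Dom sigma x p -> Q (x, rotp R p * z) = Q (x, z).
Proof.
move=> hp; apply/(q_eq_pmin _ _ hp).
have [p0 _ _] := hp.
by rewrite exprMn (prim_expr_order (rotp_prim R p0)) mul1r.
Qed.

(** [w / z] is a [p]-th root of unity, hence a power of the primitive root [rotp R p]. *)
Lemma q_inj_rotp x p z w : Tset R z -> pmin Dom sigma x p -> Q (x, z) = Q (x, w) ->
  exists n, w = rotp R p ^+ n * z.
Proof.
move=> z1 hp /(q_eq_pmin _ _ hp) e.
have [p0 _ _] := hp.
have : (w / z) ^+ p = 1.
  by rewrite expr_div_n -e divff// expf_neq0// Tset_neq0.
move=> /(prim_rootP (rotp_prim R p0))[i wz].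
by exists i; rewrite -wz divfK// Tset_neq0.
Qed.

Lemma q_aperiodic x z w : ~ dr_periodic Dom sigma x -> Q (x, z) = Q (x, w).
Proof. by move=> hp; apply: q_ext => k /(Hx_aperiodic _ hp) ->; rewrite !expr0z. Qed.

Lemma isChar0 x chi : isChar Dom sigma x chi -> chi 0 = 1.
Proof.
move=> [h1 h2 _]; have h0 := Hx0 Dom sigma x.
have /eqP := h2 0 0 h0 h0; rewrite addr0 -[X in X == _]mulr1.
by rewrite (inj_eq (mulfI (Tset_neq0 (h1 _ h0)))) => /eqP.
Qed.

(** The isotropy group is trivial or consists of the multiples of [p = p(x)]. In the latter case [z]
    is a [p]-th root of [chi p], found by dividing its angle by [p]. Off the group both functions
    are normalized to 1. *)
Lemma q_surj s : Stab Dom sigma s -> exists2 z, Tset R z & s = Q (s.1, z).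
Proof.
case: s => x chi; rewrite /Stab /= => hchi; have [h1 h2 h3] := hchi.
have chi0 := isChar0 hchi.
have [/pmin_exists[p hp]|hx] := pselect (dr_periodic Dom sigma x); last first.
  exists 1; first by rewrite /Tset /= normr1.
  rewrite /q /=; congr (_, _); apply/funext => k; case: asboolP => hk; last exact: h3.
  by move: hk => /(Hx_aperiodic _ hx) ->; rewrite expr0z.
have [p0 _ _] := hp.
have Hp : H x p by apply/(Hx_pmin _ hp); rewrite absz_nat.
have [t _ te] := cis_surj (h1 _ Hp).
have zp : cis (t / p%:R) ^+ p = chi p.
  by rewrite -cisMn -(mulr_natr (_ / _)) divfK ?pnatr_eq0 -?lt0n.
exists (cis (t / p%:R)); first exact: norm_cis.
rewrite /q /=; congr (_, _); apply/funext => k; case: asboolP => hk; last exact: h3.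
have chiM (n : nat) : H x (n * p)%N /\ chi (n * p)%N = chi p ^+ n.
  elim: n => [|n [IH1 IH2]]; first by rewrite mul0n expr0; split; [exact: Hx0|].
  rewrite mulSn PoszD exprS -IH2; split; last exact: h2.
  exact: Gset_mul Hp IH1.
move: (hk) => /(Hx_pmin _ hp)/dvdnP[a].
case: k hk => n; rewrite ?NegzE ?abszN absz_nat => hk e; rewrite e in hk *.
  by rewrite (chiM a).2 -exprnP mulnC exprM zp.
rewrite -exprnN mulnC exprM zp -(chiM a).2.
have hne : chi (a * p)%N != 0 by apply: Tset_neq0; apply: h1; exact: (chiM a).1.
by apply: (mulfI hne); rewrite mulfV// (mulnC p a) -(h2 _ _ (chiM a).1 hk) subrr.
Qed.

(** Conjugation preserves degrees, and [x] and [y] have the same isotropy degrees, so only the base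
    point moves. *)
Lemma act_q x y z k : Gset Dom sigma (y, k, x) -> act (y, k, x) (Q (x, z)) = Q (y, z).
Proof.
move=> g; rewrite /act /gmul /ginv /q /=; congr (_, _); apply/funext => l.
rewrite -(Hx_orbit g); have -> // : - k + l + k = l by ring.
Qed.

End Characters.

(** * Compact subsets of the isotropy bundle *)

Section Topology.
Context (X : topologicalType) (Dom : set X) (sigma : X -> X).
Local Notation G := (Gset Dom sigma).
Local Notation dom := (domn Dom sigma).
Local Notation s n := (iter n sigma).
Local Notation per := (per_at Dom sigma).
Implicit Types (K W : set (Triple X)).

Lemma Gopen_degree (k : int) : Gopen Dom sigma [set g | G g /\ g.1.2 = k].
Proof.
move=> g [[m [n [hm hn e gk]]] <-]; exists setT, m, n, setT; split => //.
- exact: openT.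
- exact: openT.
move=> h [_ _ hm' hn' [e' hk]]; split; last by rewrite hk -gk.
by exists m, n.
Qed.

Lemma Gopen_range (A : set X) : open A -> Gopen Dom sigma [set g | G g /\ A g.1.1].
Proof.
move=> oA g [[m [n [hm hn e gk]]] Ag]; exists A, m, n, setT; split => //.
  exact: openT.
by move=> h [Ah _ hm' hn' [e' hk]]; split => //; exists m, n.
Qed.

Lemma Gopen_ZB (U V : set X) m n : open U -> open V -> Gopen Dom sigma (ZB Dom sigma U m n V).
Proof. by move=> oU oV g hg; exists U, m, n, V; split. Qed.

(** The sets [W] cover [K], and a finite subcover calls for intersecting only finitely many members
    of the filter. *)
Lemma Gcompact_near (I : Type) (F : set_system I) (FF : Filter F) K
    (P : I -> Triple X -> Prop) : Gcompact Dom sigma K ->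
  (forall g, K g -> exists W, [/\ Gopen Dom sigma W, W g &
     \forall i \near F, forall h, W h -> P i h]) ->
  \forall i \near F, forall h, K h -> P i h.
Proof.
move=> cK h.
have [||n [f [Ff Kf]]] := cK [set W | Gopen Dom sigma W /\
    \forall i \near F, forall h, W h -> P i h].
- by move=> W [].
- by move=> g /h[W [oW Wg nW]]; exists W.
have : \forall i \near F, forall j : 'I_n, forall h, f j h -> P i h.
  by apply: filter_forall => j; have [] := Ff j.
apply: filterS => i hi g /Kf[j _]; exact: hi.
Qed.

(* Away from the fibre over [f i], a point of [K] is separated from [x0] by the Hausdorff
   property, so only the points of [K] over [x0] matter. *)
Lemma Iso_compact_near (I : Type) (F : set_system I) (FF : Filter F) (f : I -> X) x0 K
    (P : I -> int -> Prop) : hausdorff_space X -> f @ F --> x0 ->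
  Gcompact Dom sigma K -> K `<=` Iso Dom sigma ->
  (forall k, K (x0, k, x0) -> exists W, [/\ Gopen Dom sigma W, W (x0, k, x0) &
     \forall i \near F, forall k', W (f i, k', f i) -> P i k']) ->
  \forall i \near F, forall k, K (f i, k, f i) -> P i k.
Proof.
move=> hX fx0 cK KI h.
have : \forall i \near F, forall g, K g ->
    Iso Dom sigma g -> g.1.1 = f i -> P i g.1.2.
  apply: Gcompact_near cK _ => -[[y k] y'] Kg.
  have [Gg /= yy'] := KI _ Kg; rewrite -{}yy' in Kg Gg *.
  have [yx0|/eqP yx0] := pselect (y = x0).
    rewrite {}yx0 in Kg Gg *; have [W [oW Wx nW]] := h _ Kg.
    exists W; split => //; apply: filterS nW => i hi [[a k'] b] Wg [_ /= ab] afi.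
    by rewrite -ab afi in Wg; exact: hi.
  move: (hX); rewrite open_hausdorff => /(_ _ _ yx0)[[A B]] /= [].
  rewrite !inE => Ay Bx0 [oA oB AB0].
  exists [set g | G g /\ A g.1.1]; split => //; first exact: Gopen_range.
  have : \forall i \near F, B (f i) by apply: fx0; exact: open_nbhs_nbhs.
  apply: filterS => i Bi g [_ Ag] _ gi; rewrite gi in Ag.
  by have : (A `&` B) (f i) by []; rewrite AB0.
by apply: filterS => i hi k Kk; apply: (hi (f i, k, f i)) => //; exact: KI.
Qed.

(** Disjoint neighbourhoods of the two distinct iterates are pulled back by continuity. *)
Lemma not_per_near x p l : hausdorff_space X -> local_homeo Dom sigma ->
  dom (l + p) x -> ~ per x p l -> \forall y \near x, ~ per y p l.
Proof.
move=> hX lh d np.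
have dl : dom l x by apply: domn_le d; rewrite leq_addr.
have /eqP ne : s (l + p) x <> s l x by move=> e; apply: np; split.
move: (hX); rewrite open_hausdorff => /(_ _ _ ne)[[A B]] /= [].
rewrite !inE => Ax Bx [oA oB AB0].
have nA : \forall y \near x, A (s (l + p) y).
  by apply: (iter_continuous lh d); exact: open_nbhs_nbhs.
have nB : \forall y \near x, B (s l y).
  by apply: (iter_continuous lh dl); exact: open_nbhs_nbhs.
near=> y => -[_ e].
have : (A `&` B) (s l y) by split; [rewrite -e|]; near: y.
by rewrite AB0.
Unshelve. all: by end_near. Qed.

Lemma closed_per_set (K0 : set X) p l : hausdorff_space X -> local_homeo Dom sigma ->
  closed K0 -> K0 `<=` dom (l + p) -> closed (K0 `&` [set x | per x p l]).
Proof.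
move=> hX lh cK0 Kd y cy.
have K0y : K0 y by apply: cK0 => B /cy[z [[Kz _] Bz]]; exists z.
split => //; apply: contrapT => np.
by have [z [[_ pz]]] := cy _ (not_per_near hX lh (Kd _ K0y) np); apply.
Qed.

(** Part of the graph of [x |-> (x, p, x)]. Testing a character on it constrains the value at degree
    [p] alone. *)
Definition iso_section (K0 : set X) p l : set (Triple X) :=
  [set g | [/\ g.1.1 = g.2, g.1.2 = p%:Z, K0 g.2 & per g.2 p l]].

Lemma iso_section_Iso (K0 : set X) p l : iso_section K0 p l `<=` Iso Dom sigma.
Proof.
move=> [[x k] y] [/= -> -> _ h]; split => //.
by apply/(Hx_nat Dom sigma); exists l.
Qed.

(** The section is continuous on a compact set of base points: a basic open set around [(x, p, x)]
    comes with its own exponents [m] and [n], and [per_near] supplies the equation for them at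
    nearby periodic points. *)
Lemma iso_section_compact (K0 : set X) p l : hausdorff_space X -> local_homeo Dom sigma ->
  (0 < p)%N -> compact K0 -> closed K0 -> K0 `<=` dom (l + p) ->
  Gcompact Dom sigma (iso_section K0 p l).
Proof.
move=> hX lh p0 cptK0 clK0 Kd Fam oF KF.
have cK' := subclosed_compact (closed_per_set hX lh clK0 Kd) cptK0 (@subIsetl _ _ _).
(* Compactness of the base is used in the near-covering form, along the filter of all
   families containing some finite subfamily of [Fam]. *)
pose fin (S : set (set (set (Triple X)))) := exists n (f : 'I_n -> set (Triple X)),
  (forall i, Fam (f i)) /\ forall Sub, (forall i, Sub (f i)) -> S Sub.
have Ffin : Filter fin.
  split.
  - by exists 0%N, (fun=> set0); split => // -[].
  - move=> S T [m [f [Ff fS]]] [n [g [Fg gT]]].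
    exists (m + n)%N, (fun i => match fintype.split i with inl j => f j | inr j => g j end).
    split=> [i|Sub h]; first by case: fintype.split.
    split; [apply: fS => i|apply: gT => i].
      by have := h (lshift n i); rewrite (unsplitK (inl i)).
    by have := h (rshift m i); rewrite (unsplitK (inr i)).
  - by move=> S T ST [n [f [Ff fS]]]; exists n, f; split => // Sub /fS /ST.
have := (compact_near_coveringP _).1 cK' _ fin
  (fun Sub x => per x p l -> exists2 W, Sub W & W (x, p%:Z, x)) Ffin.
case=> [x [Kx hx]|n [f [Ff hf]]]; last first.
  exists n, f; split => // -[[x k] y] [/= -> -> Ky hy].
  have [_ [i _ <-] Wi] := hf (range f) (fun i => imageT f i) y (conj Ky hy) hy.
  by exists i.
have [W FW Wx] := KF (x, p%:Z, x) (And4 erefl erefl Kx hx).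
have [U [m [n [V [oU oV [/= Ux Vx dm dn [e mn]] UW]]]]] := oF _ FW _ Wx.
have nU : nbhs x U by exact: open_nbhs_nbhs.
have nV : nbhs x V by exact: open_nbhs_nbhs.
exists ([set y | per y p l -> W (y, p%:Z, y)], [set Sub : set (set (Triple X)) | Sub W]).
  split; last by exists 1%N, (fun=> W); split => // Sub; apply; exact: ord0.
  have := per_near lh p0 hx e (esym mn).
  apply: filter_app; near=> y => eq hy; apply: UW; split => //=.
  - by near: y.
  - by near: y.
  - exact: per_domn hy.
  - exact: per_domn hy.
  - by split => //; exact: eq.
by move=> [y Sub] /= [h SW] hy; exists W => //; exact: h.
Unshelve. all: by end_near. Qed.

End Topology.

(** * Basic open sets of the dual isotropy bundle *)

Section BasicOpenSets.
Context (R : realType) (X : topologicalType) (Dom : set X) (sigma : X -> X).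
Hypotheses (hX : hausdorff_space X) (lh : local_homeo Dom sigma).
Local Notation per := (per_at Dom sigma).
Local Notation Q := (q Dom sigma).
Local Notation H := (Hx Dom sigma).
Implicit Types (x y : X) (z w : CC R) (B : set X * set (Triple X) * set (CC R)).

(** The degree is locally constant, so near [(x0, k, x0)] the test on [K] becomes the open condition
    that [z ^ k] lies in [O]. *)
Lemma Obasic_q_near B x0 z0 : Tset R z0 -> admissible Dom sigma B ->
  Obasic Dom sigma B (Q (x0, z0)) ->
  \forall p \near (x0, z0), Tset R p.2 -> Obasic Dom sigma B (Q p).
Proof.
case: B => [[U K] V] z01 [/= oU cK KI [O [oO ->]]] [_ /= Ux0 hK].
have z00 := Tset_neq0 z01.
have nU : \forall p \near (x0, z0), U p.1.
  by apply: cvg_fst; exact: open_nbhs_nbhs.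
have : \forall p \near (x0, z0), forall k : int, K (p.1, k, p.1) ->
    Tset R p.2 -> (O `&` Tset R) ((Q p).2 k).
  apply: (@Iso_compact_near _ Dom sigma _ _ _ fst x0 K _ hX cvg_fst cK KI).
  move=> k Kk; have [Gk _] := KI _ Kk.
  exists [set g | Gset Dom sigma g /\ g.1.2 = k]; split => //; first exact: Gopen_degree.
  have [Ok _] := hK k Kk; rewrite asboolT// in Ok.
  have : \forall p \near (x0, z0), O (p.2 ^ k).
    have nO : nbhs (z0 ^ k) O by exact: open_nbhs_nbhs.
    have nOk : \forall w \near z0, O (w ^ k) := cvg_exprz z00 nO.
    exists (setT, [set w | O (w ^ k)]); first by split => //; exact: filterT.
    by move=> [x z] [].
  apply: filterS => -[x z] /= Oz k' [Gk' /= kk'] zT; rewrite kk' in Gk' *.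
  by rewrite asboolT//; split => //; exact: TsetXz.
move=> nK; near=> p => pT; split => [||k Kk].
- exact: (q_Stab _ _ p.1 pT).
- by near: p.
- by move: k Kk pT; near: p.
Unshelve. all: by end_near. Qed.

(* A compact set of isotropy elements meets the fibre over a point [x] near [x0] with
   [l(x) <> l(x0)] only in the unit, where every character takes the value 1. *)
Lemma Obasic_lmin_near B x0 z0 l : admissible Dom sigma B ->
  Obasic Dom sigma B (Q (x0, z0)) -> lmin Dom sigma x0 l ->
  \forall x \near x0, l_of Dom sigma x <> Some l ->
    forall chi : int -> CC R, isChar Dom sigma x chi -> Obasic Dom sigma B (x, chi).
Proof.
case: B => [[U K] V] [/= oU cK KI [O [oO ->]]] [_ /= Ux0 hK] hl.
have nU : nbhs x0 U by exact: open_nbhs_nbhs.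
have : \forall x \near x0, forall k : int, K (x, k, x) ->
    l_of Dom sigma x <> Some l -> k = 0 /\ O 1.
  apply: (@Iso_compact_near _ Dom sigma _ _ _ id x0 K _ hX cvg_id cK KI) => k Kk.
  have [Gk _] := KI _ Kk.
  have [k0|/eqP k0] := pselect (k = 0).
    exists [set g | Gset Dom sigma g /\ g.1.2 = k]; split => //; first exact: Gopen_degree.
    apply: filterE => x k' [_ /= ->] _; split => //.
    by have [+ _] := hK k Kk; rewrite asboolT// k0 expr0z.
  have [n hn] := (Hx_nat Dom sigma _ _).1 ((Hx_absz _ _ _ _).1 Gk).
  have a0 : (0 < `|k|)%N by rewrite absz_gt0.
  have hkl := lmin_per a0 hn hl.
  (* The sign of [k] decides the order of the exponents [l] and [l + |k|]; membership in [ZB] then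
     makes [|k|] a period from [l] on. *)
  have [a [b [ab eab]]] : exists a b : nat, (a%:Z - b%:Z = k) /\
      ((a = l + `|k|)%N /\ b = l \/ a = l /\ (b = l + `|k|)%N).
    by case: (lerP 0 k) => hk; [exists (l + `|k|)%N, l|exists l, (l + `|k|)%N]; split; lia || auto.
  exists (ZB Dom sigma setT a b setT); split.
  - exact: Gopen_ZB openT openT.
  - split => //=; [exact: per_domn hkl|exact: per_domn hkl|split => //].
    by case: eab => -[-> ->]; rewrite hkl.2.
  (* This excludes [l(x) < l], while [ZB] gives [l(x) <= l]. The guard is there because [l.-1] is 0
     when [l = 0]. *)
  have nn : \forall x \near x0, (0 < l)%N -> ~ per x `|k|%N l.-1.
    have [l0|l0] := posnP l; first by apply: filterE => x; rewrite l0.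
    have dx0 : domn Dom sigma (l.-1 + `|k|) x0 by exact: per_domn hn.
    have np : ~ per x0 `|k|%N l.-1.
      by move=> h; have := lmin_le a0 h hl; rewrite leqNgt prednK// leqnn.
    by apply: filterS (not_per_near hX lh dx0 np) => x.
  apply: filterS nn => x nx k' [_ _ /= da db [e k'k]].
  case=> //.
  have hxl : per x `|k|%N l by case: eab => -[ea eb]; rewrite ea eb in da db e.
  have [l' hl'] : exists l', lmin Dom sigma x l'.
    by apply: lmin_exists; exists `|k|%N, l.
  rewrite (l_of_lmin hl'); congr Some; apply/eqP; rewrite eqn_leq (lmin_le a0 hxl hl').
  rewrite leqNgt; apply/negP => ll; apply: nx; first by case: (l) ll.
  apply: per_le (lmin_per a0 hxl hl') => //.
  by case: (l) ll.
move=> nK; apply: filterS (filterI nU nK) => x [Ux hx] hlx chi hchi.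
split => // k Kk /=; have [-> O1] := hx k Kk hlx.
by rewrite (isChar0 hchi); split => //; rewrite /Tset /= normr1.
Qed.

End BasicOpenSets.

(** * Fibres of a relatively closed set, and compact neighbourhoods in the base *)

Section Fibres.
Context (R : realType) (X : topologicalType) (Dom : set X) (sigma : X -> X).
Implicit Types (x y : X) (z w : CC R) (Y F : set (X * CC R)).

Lemma near_not_relclosed Y F x0 z0 : closed F -> Y = F `&` ([set: X] `*` Tset R) ->
  Tset R z0 -> ~ Y (x0, z0) -> \forall p \near (x0, z0), ~ Y p.
Proof.
move=> cF YF z01 nY.
have nF : (~` F) (x0, z0) by move=> Fx; apply: nY; rewrite YF.
have : nbhs (x0, z0) (~` F).
  by apply: open_nbhs_nbhs; split => //; exact: closed_openC.
by apply: filterS => p nFp; rewrite YF => -[].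
Qed.

(** Tube argument: each angle has a product neighbourhood avoiding [Y], and compactness of the
    interval of angles makes the base neighbourhood uniform. *)
Lemma Yfib_empty_near Y F x0 : closed F -> Y = F `&` ([set: X] `*` Tset R) ->
  Yfib Y x0 = set0 -> \forall x \near x0, Yfib Y x = set0.
Proof.
move=> cF YF Y0.
have nt : \forall x \near x0, `[0, pi *+ 2]%classic `<=` (fun t : R => ~ Y (x, cis t)).
  apply: ((compact_near_coveringP _).1 (@segment_compact R 0 (pi *+ 2)) X (nbhs x0)
    (fun x t => ~ Y (x, cis t)) (nbhs_filter x0)) => t _.
  have nY : ~ Y (x0, cis t).
    by move=> h; have : Yfib Y x0 (cis t) by []; rewrite Y0.
  have [[A B] /= [nA nB] AB] := near_not_relclosed cF YF (norm_cis t) nY.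
  exists (@cis R @^-1` B, A); first by split => //; exact: cis_continuous nB.
  by move=> [u x] /= [Bu Ax]; exact: (AB (x, cis u)).
apply: filterS nt => x nx; rewrite -subset0 => z Yxz.
have z1 : Tset R z by move: Yxz; rewrite /Yfib /= YF => -[_ []].
have [t tI zt] := cis_surj z1.
by apply: (nx t); [rewrite /= in_itv | rewrite -zt].
Qed.

Lemma compact_nbhs x0 (N : set X) : hausdorff_space X -> locally_compact [set: X] ->
  nbhs x0 N -> exists K, [/\ nbhs x0 K, compact K, closed K & K `<=` N].
Proof.
move=> hX lc nN.
have [U nU' [cU clU]] := lc x0 Logic.I.
have nU : nbhs x0 U by move: nU'; rewrite /within/=; apply: filterS => y; apply.
have [B nB BN] := compact_regular hX cU nU nN.
exists (U `&` closure B); split.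
- by apply: filterI => //; apply: filterS nB; exact: subset_closure.
- apply: subclosed_compact cU (@subIsetl _ _ _).
  by apply: closedI => //; exact: closed_closure.
- by apply: closedI => //; exact: closed_closure.
- by move=> y [_ /BN].
Qed.

Lemma Yfib_rotpX Y x p z n : [set rotp R p * z | z in Yfib Y x] = Yfib Y x ->
  Y (x, z) -> Y (x, rotp R p ^+ n * z).
Proof.
move=> hrot Yz; elim: n => [|n IH]; first by rewrite expr0 mul1r.
have : Yfib Y x (rotp R p * (rotp R p ^+ n * z)) by rewrite -hrot; exists (rotp R p ^+ n * z).
by rewrite mulrA -exprS.
Qed.

Lemma Yfib_orbit Y m n x y : (forall x, Dom x -> Yfib Y x = Yfib Y (sigma x)) ->
  domn Dom sigma m x -> domn Dom sigma n y -> iter m sigma x = iter n sigma y ->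
  Yfib Y x = Yfib Y y.
Proof.
move=> hY.
have iterY k u : domn Dom sigma k u -> Yfib Y u = Yfib Y (iter k sigma u).
  elim: k => [//|k IH] d; rewrite IH; last exact: domn_le d.
  by rewrite hY//; exact: d.
by move=> dm dn e; rewrite (iterY _ _ dm) e -iterY.
Qed.

End Fibres.

(** * The two directions *)

Section Equivalence.
Context (R : realType) (X : topologicalType) (Dom : set X) (sigma : X -> X).
Hypotheses (hX : hausdorff_space X) (lh : local_homeo Dom sigma).
Local Notation Q := (q Dom sigma).
Implicit Types (x y : X) (z w : CC R).

(** * From an invariant closed set to the three conditions *)

Section InvariantToConditions.
Variables (C : set (SP R X)) (Y : set (X * CC R)).
Hypotheses (cC : Stab_closed Dom sigma C) (iC : Ginvariant Dom sigma C).
Hypothesis YC : Y = ([set: X] `*` Tset R) `&` (Q @^-1` C).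

Lemma memYC x z : Tset R z -> Y (x, z) <-> C (Q (x, z)).
Proof. by move=> z1; rewrite YC; split=> [[]|h]. Qed.

Lemma memY_Tset x z : Y (x, z) -> Tset R z.
Proof. by rewrite YC => -[[_ ?]]. Qed.

Lemma notC_basic x0 z0 : Tset R z0 -> ~ Y (x0, z0) ->
  exists (n : nat) (B : 'I_n -> set X * set (Triple X) * set (CC R)),
    [/\ forall i, admissible Dom sigma (B i),
        forall i, Obasic Dom sigma (B i) (Q (x0, z0)) &
        forall t, Stab Dom sigma t -> (forall i, Obasic Dom sigma (B i) t) -> ~ C t].
Proof.
move=> z01 nY; have [_ [_ oC]] := cC.
have [|n [B [aB sB tB]]] := oC (Q (x0, z0)).
  by split; [exact: q_Stab | move/(memYC _ z01)].
by exists n, B; split => // t St Bt; have [] := tB t St Bt.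
Qed.

(** The closure of [Y] serves as [F]: around a point of the circle bundle outside [Y], the map [q]
    stays in a basic neighbourhood disjoint from [C]. *)
Lemma invariant_closed : exists F, closed F /\ Y = F `&` ([set: X] `*` Tset R).
Proof.
exists (closure Y); split; first exact: closed_closure.
apply/seteqP; split=> [p Yp|[x z] [cYp [_ /= z1]]].
  by split; [exact: subset_closure | move: Yp; rewrite YC => -[]].
apply: contrapT => nY.
have [n [B [aB sB tB]]] := notC_basic z1 nY.
have nB : \forall p \near (x, z), forall i, Tset R p.2 -> Obasic Dom sigma (B i) (Q p).
  apply: (@filter_forall _ _ (fun i p => Tset R p.2 -> Obasic Dom sigma (B i) (Q p))
    _ (nbhs_filter (x, z))).
  by move=> i; exact: Obasic_q_near.
have [[x' z'] [Yp hp]] := cYp _ nB.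
have z'1 := memY_Tset Yp.
have Sq := q_Stab Dom sigma x' z'1.
by apply: (tB _ Sq) => [i|]; [exact: hp|exact/memYC].
Qed.

(** The element [(x, 1, sigma x)] and its inverse exchange [q (x, z)] and [q (sigma x, z)]. *)
Lemma invariant_orbit x : Dom x -> Yfib Y x = Yfib Y (sigma x).
Proof.
move=> Dx.
have g : Gset Dom sigma (x, 1, sigma x).
  by exists 1%N, 0%N; split => //= -[].
apply/seteqP; split=> z Yz; have z1 := memY_Tset Yz; apply/(memYC _ z1).
  by rewrite -(act_q z (Gset_inv g)); apply: iC => //; [exact: Gset_inv|exact/memYC].
by rewrite -(act_q z g); apply: iC => //; exact/memYC.
Qed.

Lemma invariant_rotp x p : pmin Dom sigma x p ->
  [set rotp R p * z | z in Yfib Y x] = Yfib Y x.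
Proof.
move=> hp; have [p0 _ _] := hp.
have rY w : Y (x, w) -> Y (x, rotp R p * w).
  move=> Yw; have w1 := memY_Tset Yw.
  by apply/memYC; [exact: TsetM (norm_rotp R p) w1 | rewrite q_rotp//; exact/memYC].
apply/seteqP; split=> [_ [z Yz <-]|z Yz]; first exact: rY.
(* This power is the inverse of [rotp R p]. *)
exists (rotp R p ^+ p.-1 * z).
  by elim: p.-1 => [|n IH]; rewrite ?mul1r// exprS -mulrA; exact: rY.
by rewrite mulrA -exprS prednK// (prim_expr_order (rotp_prim R p0)) mul1r.
Qed.

(** Over a non-periodic point [q] does not depend on [z], so the fibre would be empty or the whole
    circle. *)
Lemma invariant_periodic x0 : Yfib Y x0 <> set0 -> Yfib Y x0 <> Tset R ->
  dr_periodic Dom sigma x0 /\ exists2 z0, Tset R z0 & ~ Y (x0, z0).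
Proof.
move=> Y0 YT.
have [z0 z01 nY] : exists2 z0, Tset R z0 & ~ Y (x0, z0).
  apply: contrapT => h; apply: YT; apply/seteqP; split=> z; first exact: memY_Tset.
  by move=> z1; apply: contrapT => nY; apply: h; exists z.
split; last by exists z0.
apply: contrapT => np; apply: Y0; rewrite -subset0 => z Yz.
apply: nY; apply/(memYC _ z01); rewrite (q_aperiodic z0 z np).
by apply/memYC => //; exact: memY_Tset Yz.
Qed.

(** By [Obasic_lmin_near], a basic neighbourhood disjoint from [C] contains every character over the
    nearby points with [l(x) <> l]. *)
Lemma invariant_lmin x0 z0 l : Tset R z0 -> ~ Y (x0, z0) -> lmin Dom sigma x0 l ->
  \forall x \near x0, l_of Dom sigma x <> Some l -> Yfib Y x = set0.
Proof.
move=> z01 nY hl.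
have [n [B [aB sB tB]]] := notC_basic z01 nY.
have : \forall x \near x0, forall i, l_of Dom sigma x <> Some l ->
    forall chi : int -> CC R, isChar Dom sigma x chi -> Obasic Dom sigma (B i) (x, chi).
  by apply: filter_forall => i; exact: Obasic_lmin_near.
apply: filterS => x hx hlx; rewrite -subset0 => z Yz.
have z1 := memY_Tset Yz; have St := q_Stab Dom sigma x z1.
apply: (tB _ St); last exact/memYC.
by move=> i; exact: hx.
Qed.

End InvariantToConditions.

(** * From the three conditions to an invariant closed set *)

Section ConditionsToInvariant.
Variables (Y F : set (X * CC R)).
Hypotheses (lcX : locally_compact [set: X]) (cF : closed F).
Hypothesis YF : Y = F `&` ([set: X] `*` Tset R).
Hypothesis Yorb : forall x, Dom x -> Yfib Y x = Yfib Y (sigma x).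
Hypothesis Yper : forall x0, Yfib Y x0 <> set0 -> Yfib Y x0 <> Tset R ->
  [/\ dr_periodic Dom sigma x0,
      (forall p, p_of Dom sigma x0 = Some p ->
         [set rotp R p * z | z in Yfib Y x0] = Yfib Y x0) &
      exists V : set X, nbhs x0 V /\
        forall x, V x -> l_of Dom sigma x <> l_of Dom sigma x0 -> Yfib Y x = set0].

Lemma YF_Tset x z : Y (x, z) -> Tset R z.
Proof. by rewrite YF => -[_ [_ ?]]. Qed.

(** The points [z] and [w] witness that the fibre is neither empty nor full, so that condition (iii)
    applies. *)
Lemma Y_rotpX x p z w n : Y (x, z) -> Tset R w -> ~ Y (x, w) ->
  pmin Dom sigma x p -> Y (x, rotp R p ^+ n * z).
Proof.
move=> Yz w1 nYw hp.
have [||_ hrot _] := Yper (x0 := x).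
- by move=> Y0; have : Yfib Y x z by []; rewrite Y0.
- by move=> YT; apply: nYw; rewrite -[Y _]/(Yfib Y x w) YT.
by apply: Yfib_rotpX Yz; apply: hrot; exact: p_of_pmin.
Qed.

(** A missing [w] would make (iii) applicable, and [w] is a rotation of [z] by a [p(x)]-th root of
    unity. *)
Lemma Y_saturated x z w : Tset R w -> Q (x, z) = Q (x, w) -> Y (x, z) -> Y (x, w).
Proof.
move=> w1 e Yz; apply: contrapT => nYw.
have [||per_x _ _] := Yper (x0 := x).
- by move=> Y0; have : Yfib Y x z by []; rewrite Y0.
- by move=> YT; apply: nYw; rewrite -[Y _]/(Yfib Y x w) YT.
have [p hp] := pmin_exists per_x.
have [n wz] := q_inj_rotp (YF_Tset Yz) hp e.
by apply: (nYw); rewrite wz; exact: Y_rotpX Yz w1 nYw hp.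
Qed.

Lemma q_preimage : Y = ([set: X] `*` Tset R) `&` (Q @^-1` (Q @` Y)).
Proof.
apply/seteqP; split=> [[x z] Yz|[x w] [[_ /= w1]] [[y z] Yz e]].
  by split; [split => //; exact: YF_Tset Yz | exists (x, z)].
have yx : y = x by exact: (congr1 fst e).
by rewrite yx in Yz e; exact: Y_saturated e Yz.
Qed.

Lemma q_image_invariant : Ginvariant Dom sigma (Q @` Y).
Proof.
move=> [[y k] x] s g /= xs [[x' z] Yz e]; rewrite -{s}e /= in xs *.
rewrite -{x'}xs in Yz *.
exists (y, z); last by rewrite (act_q z g).
have [m [n [/= dm dn e _]]] := g.
by rewrite -[Y _]/(Yfib Y y z) (Yfib_orbit Yorb dm dn e).
Qed.

Lemma complement_nbhs x0 z0 : Tset R z0 -> ~ Y (x0, z0) ->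
  exists (n : nat) (B : 'I_n -> set X * set (Triple X) * set (CC R)),
    [/\ forall i, admissible Dom sigma (B i),
        forall i, Obasic Dom sigma (B i) (Q (x0, z0)) &
        forall x z, Y (x, z) -> ~ (forall i, Obasic Dom sigma (B i) (Q (x, z)))].
Proof.
move=> z01 nY.
have [Y0|Y0] := pselect (Yfib Y x0 = set0).
  have nU := Yfib_empty_near cF YF Y0.
  (* The compact set is empty, so the neighbourhood restricts the base point only. *)
  exists 1%N, (fun=> ((fun x => Yfib Y x = set0)°, set0, setT `&` Tset R)); split.
  - move=> _; split => //=; first exact: open_interior.
      by move=> *; exists 0%N, (fun=> set0); split => [[]|].
    by exists setT; split => //; exact: openT.
  - by move=> _; split => //; exact: q_Stab.
  - move=> x z Yz /(_ ord0)[_ /= /interior_subset h _].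
    by have : Yfib Y x z by []; rewrite h.
have [|perx0 _ [V [nV VY]]] := Yper Y0.
  by move=> YT; apply: nY; rewrite -[Y _]/(Yfib Y x0 z0) YT.
have [l hl] := lmin_exists perx0.
have lx0 := l_of_lmin hl.
have [[A B0] /= [nA nB0] AB] := near_not_relclosed cF YF z01 nY.
have [e /= e0 eB] := (@nbhs_ballP _ (CC R : pseudoMetricType _) _ _).1 nB0.
(* For [p > N] some [p]-th root of unity rotates any given point of the circle to within [e] of
   [z0]. *)
have [N hN] := rotp_dense e0.
have nd : nbhs x0 (domn Dom sigma (l + N.+1)).
  apply: domn_nbhs => //; have [p [n [p0 hp]]] := perx0; exact: per_domn hp.
have [K0 [nK0 cptK0 clK0 K0d]] := compact_nbhs hX lcX nd.
pose U := (A `&` V `&` K0)°.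
have Ux0 : U x0 by do 2?apply: filterI.
pose O (p : nat) := (ball (z0 ^+ p) (e ^+ p))°.
(* Index [i] tests degree [i + 1]. There is at least one index even for [N = 0], so the condition on
   the base point can be read at [ord0]. *)
exists N.+1, (fun i : 'I_N.+1 => (U, iso_section Dom sigma K0 i.+1 l, O i.+1 `&` Tset R)); split.
- move=> i; split => /=.
  + exact: open_interior.
  + apply: iso_section_compact => // y /K0d; apply: domn_le.
    by rewrite leq_add2l ltn_ord.
  + exact: iso_section_Iso.
  + by exists (O i.+1); split => //; exact: open_interior.
- move=> i; split => //=; first exact: q_Stab.
  move=> k [/= _ -> _ hp].
  have hH : Hx Dom sigma x0 i.+1 by apply/Hx_nat; exists l.
  rewrite asboolT//; split; last exact: (TsetXz i.+1 z01).
  by apply: nbhsx_ballx; rewrite exprn_gt0.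
- move=> x z Yz hB.
  have [_ /= /interior_subset[[Ax Vx] K0x] _] := hB ord0.
  (* With [z0] missing from the fibre at [x], that fibre is invariant under the [p(x)]-th roots of
     unity. *)
  have nYx : ~ Y (x, z0) by apply: (AB (x, z0)); split => //=; apply: nbhs_singleton.
  have lx : l_of Dom sigma x = Some l.
    apply: contrapT; rewrite -lx0 => /(VY _ Vx) Yx0.
    by have : Yfib Y x z by []; rewrite Yx0.
  have [p [hp hpl _]] := l_of_Some lx.
  have [p0 _ _] := hp.
  have z1 := YF_Tset Yz.
  (* All these rotations of [z] stay in the fibre at [x], which avoids the [e]-ball around [z0]. *)
  have rot n : e <= `|rotp R p ^+ n * z - z0|.
    rewrite real_leNgt ?normr_real ?gtr0_real//; apply/negP => lt.
    have := Y_rotpX n Yz z01 nYx hp.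
    by apply: (AB (x, _)); split => //=; apply: eB; rewrite /ball /= distrC.
  have [Np|pN] := ltnP N p.
    have [k hk] := hN p Np z z0 z1 z01.
    by have := le_lt_trans (rot k) hk; rewrite ltxx.
  (* Degree [p] is tested at index [p.-1]; the test puts [z ^+ p] within [e ^+ p] of [z0 ^+ p],
     against [rotp_sub_prod]. *)
  have pN1 : (p.-1 < N.+1)%N by rewrite prednK// ltnW.
  have [_ _ /(_ p)] := hB (Ordinal pN1).
  rewrite /= prednK//.
  have hH : Hx Dom sigma x p by apply/Hx_nat; exists l.
  rewrite asboolT// => -[//|/interior_subset + _].
  rewrite /ball /= distrC => /(le_lt_trans (rotp_sub_prod p0 z1 (ltW e0) rot)).
  by rewrite ltxx.
Qed.

Lemma q_image_closed : Stab_closed Dom sigma (Q @` Y).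
Proof.
split=> [_ [[x z] Yz <-]|]; first by apply: q_Stab; exact: YF_Tset Yz.
split=> [s []//|s [Ss nCs]].
have [z0 z01 es] := q_surj Ss; rewrite es in Ss nCs *.
have nY : ~ Y (s.1, z0) by move=> h; apply: nCs; exists (s.1, z0).
have [n [B [aB sB tB]]] := complement_nbhs z01 nY.
exists n, B; split => // t St Bt; split => // -[[x z] Yz e].
by apply: (tB _ _ Yz); rewrite e.
Qed.

End ConditionsToInvariant.
End Equivalence.

Theorem theorem3p14 (R : realType) (X : topologicalType) (Dom : set X)
  (sigma : X -> X) (Y : set (X * CC R)) :
  hausdorff_space X -> locally_compact [set: X] -> local_homeo Dom sigma ->
  Y `<=` [set: X] `*` Tset R ->
  ((exists C : set (SP R X),
      [/\ Stab_closed Dom sigma C, Ginvariant Dom sigma C &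
          Y = ([set: X] `*` Tset R) `&` (q Dom sigma @^-1` C)]) <->
   [/\ (exists F : set (X * CC R), closed F /\ Y = F `&` ([set: X] `*` Tset R)),
       (forall x, Dom x -> Yfib Y x = Yfib Y (sigma x)) &
       (forall x0, Yfib Y x0 <> set0 -> Yfib Y x0 <> Tset R ->
          [/\ dr_periodic Dom sigma x0,
              (forall p, p_of Dom sigma x0 = Some p ->
                 [set rotp R p * z | z in Yfib Y x0] = Yfib Y x0) &
              exists V : set X, nbhs x0 V /\
                forall x, V x -> l_of Dom sigma x <> l_of Dom sigma x0 ->
                  Yfib Y x = set0])]).
Proof.
move=> hX lcX lh YT; split=> [[C [cC iC YC]]|[[F [cF YF]] Yorb Yper]].
  split; first exact: (invariant_closed hX cC YC).
    by move=> x; exact: (invariant_orbit iC YC).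
  move=> x0 Y0 YT0; have [per_x0 [z0 z01 nY]] := invariant_periodic YC Y0 YT0.
  have [l hl] := lmin_exists per_x0.
  split=> // [p /p_of_Some hp|]; first exact: (invariant_rotp YC hp).
  exists [set x | l_of Dom sigma x <> Some l -> Yfib Y x = set0].
  by rewrite (l_of_lmin hl); split => //; exact: (invariant_lmin hX lh cC YC z01 nY hl).
exists (q Dom sigma @` Y); split.
- exact: (q_image_closed hX lh lcX cF YF Yper).
- exact: (q_image_invariant Yorb).
- exact: (q_preimage YF Yper).
Qed.
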